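(* Let $(G,f)$ be an $n$-ary group and let $\mu:G\to[0,1]$ be a fuzzy subset of $G$. Then $\mu$ is a fuzzy $n$-ary subgroup of $(G,f)$ if and only if each nonempty level subset $\mu_t=\{x\in G\mid \mu(x)\ge t\}$, $t\in[0,1]$, is an $n$-ary subgroup of $(G,f)$.
   Context: Let $n\ge 2$. An $n$-ary group $(G,f)$ is a nonempty set $G$ with an operation $f:G^n\to G$ such that (a) $f$ is associative: for all $1\le i<j\le n$ and all $x_1,\dots,x_{2n-1}\in G$, $f(x_1,\dots,x_{i-1},f(x_i,\dots,x_{n+i-1}),x_{n+i},\dots,x_{2n-1})=f(x_1,\dots,x_{j-1},f(x_j,\dots,x_{n+j-1}),x_{n+j},\dots,x_{2n-1})$; and (b) for every $i\in\{1,\dots,n\}$ and all $x_0,x_1,\dots,x_n\in G$ there is a unique $z\in G$ with $f(x_1,\dots,x_{i-1},z,x_{i+1},\dots,x_n)=x_0$. The skew element $\overline{x}$ of $x\in G$ is the unique element with $f(x,\dots,x,\overline{x})=x$ ($x$ repeated $n-1$ times). A nonempty $H\subseteq G$ is an $n$-ary subgroup if it is closed under $f$ and $x\in H$ implies $\overline{x}\in H$. A fuzzy subset of $G$ is a function $\mu:G\to[0,1]$. It is a fuzzy $n$-ary subgroup of $(G,f)$ if (i) $\mu(f(x_1,\dots,x_n))\ge\min\{\mu(x_1),\dots,\mu(x_n)\}$ for all $x_1,\dots,x_n\in G$, and (ii) $\mu(\overline{x})\ge\mu(x)$ for all $x\in G$. *)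

(* Defs.v *)
From mathcomp Require Import all_boot all_order all_algebra.
From mathcomp Require Import boolp classical_sets reals.

Set Implicit Arguments.
Unset Strict Implicit.
Unset Printing Implicit Defensive.

Import Order.TTheory GRing.Theory Num.Theory.
Local Open Scope classical_set_scope.
Local Open Scope ring_scope.

(* Positions are numbered from 0, and only x 0, ..., x (2n-2) are used: this is
   f (x_0, .., x_{i-1}, f (x_i, .., x_{i+n-1}), x_{i+n}, .., x_{2n-2}). *)
Definition nest (n : nat) (T : Type) (f : n.-tuple T -> T) (i : nat)
    (x : nat -> T) : T :=
  f [tuple if (k < i)%N then x k
           else if k == i :> nat then f [tuple x (i + l)%N | l < n]
           else x (k + n.-1)%N | k < n].

Definition replace_at (n : nat) (T : Type) (x : n.-tuple T) (i : 'I_n) (z : T) :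
    n.-tuple T :=
  [tuple if k == i then z else tnth x k | k < n].

Record naryGroup (n : nat) := NaryGroup {
  carrier :> Type;
  op : n.-tuple carrier -> carrier;
  arity_ge2 : (2 <= n)%N;
  carrier_nonempty : inhabited carrier;
  op_assoc : forall (i j : 'I_n) (x : nat -> carrier),
    (i < j)%N -> nest op i x = nest op j x;
  op_solvable : forall (i : 'I_n) (x0 : carrier) (x : n.-tuple carrier),
    exists! z : carrier, op (replace_at x i z) = x0
}.

(* (x, .., x, z) with x repeated n - 1 times. *)
Definition const_but_last (n : nat) (T : Type) (x z : T) : n.-tuple T :=
  [tuple if k.+1 == n then z else x | k < n].

Lemma skew_exists_unique (n : nat) (G : naryGroup n) (x : G) :
  exists! z : G, op (const_but_last n x z) = x.
Proof.
have n0 : (0 < n)%N := ltnW (arity_ge2 G).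
have n1 : (n.-1 < n)%N by rewrite ltn_predL.
have E z : const_but_last n x z =
    replace_at [tuple x | k < n] (Ordinal n1) z.
  apply: eq_from_tnth => k; rewrite !tnth_mktuple -val_eqE /=.
  by rewrite -[k == _ :> nat]eqSS prednK.
have [z [hz uz]] := op_solvable (Ordinal n1) x [tuple x | k < n].
by exists z; split=> [|y]; rewrite E //; apply: uz.
Qed.

Lemma skew_exists (n : nat) (G : naryGroup n) (x : G) :
  exists z : G, op (const_but_last n x z) = x.
Proof. by have [z [hz _]] := skew_exists_unique x; exists z. Qed.

Definition skew (n : nat) (G : naryGroup n) (x : G) : G :=
  projT1 (cid (skew_exists x)).

Lemma skewP (n : nat) (G : naryGroup n) (x : G) :
  op (const_but_last n x (skew x)) = x.
Proof. exact: projT2 (cid (skew_exists x)). Qed.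

Lemma skew_unique (n : nat) (G : naryGroup n) (x z : G) :
  op (const_but_last n x z) = x -> z = skew x.
Proof.
move=> hz; have [y [_ uy]] := skew_exists_unique x.
by rewrite -(uy _ hz) (uy _ (skewP x)).
Qed.

Definition nary_subgroup (n : nat) (G : naryGroup n) (H : set G) : Prop :=
  [/\ H !=set0,
      forall x : n.-tuple G, (forall i, H (tnth x i)) -> H (op x)
    & forall x : G, H x -> H (skew x)].

Definition fuzzy_subset (R : realType) (T : Type) (mu : T -> R) : Prop :=
  forall x, 0 <= mu x <= 1.

(* The default value 1 does not affect the minimum when mu is a fuzzy subset,
   since then mu <= 1 and n >= 2 > 0. *)
Definition fuzzy_nary_subgroup (R : realType) (n : nat) (G : naryGroup n)
    (mu : G -> R) : Prop :=
  [/\ fuzzy_subset mu,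
      forall x : n.-tuple G,
        \big[Num.min/1]_(i < n) mu (tnth x i) <= mu (op x)
    & forall x : G, mu x <= mu (skew x)].

Definition level_subset (R : realType) (T : Type) (mu : T -> R) (t : R) :
    set T :=
  [set x | t <= mu x].

(* Main.v *)
Require Import Defs.
From mathcomp Require Import all_boot all_order all_algebra.
From mathcomp Require Import boolp classical_sets reals.

(** A level subset [mu_t] is closed under an operation as soon as [mu] does not
decrease below the minimum of its arguments: if all arguments have degree at
least [t], so does their minimum.  Conversely, each fuzzy inequality is the
closure property of one well-chosen level subset: the one at
[t = min (mu x_1, .., mu x_n)] for the operation, and the one at [t = mu x] for
the skew element.  These levels lie in [0, 1] because [mu] does, and the
corresponding level subsets are nonempty because they contain the arguments
themselves. *)

Set Implicit Arguments.
Unset Strict Implicit.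
Unset Printing Implicit Defensive.

Import Order.TTheory GRing.Theory Num.Theory.
Local Open Scope classical_set_scope.
Local Open Scope ring_scope.

Theorem theorem2p7 (R : realType) (n : nat) (G : naryGroup n) (mu : G -> R)
    (mu01 : fuzzy_subset mu) :
  fuzzy_nary_subgroup mu <->
  (forall t : R, 0 <= t <= 1 -> level_subset mu t !=set0 ->
     nary_subgroup (level_subset mu t)).
Proof.
split=> [[_ mu_op mu_skew] t /andP[_ t1] mut0 | sub].
  split=> // [x mut_x | x]; last by move=> /le_trans; apply.
  by apply: le_trans _ (mu_op x); apply: le_bigmin => // i _; apply: mut_x.
split=> // x; last first.
  have [|_ _] := sub (mu x) (mu01 x); first by exists x; apply: lexx.
  by apply; apply: lexx.
set t := \big[Num.min/1]_(i < n) _.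
have t_le i : t <= mu (tnth x i) by apply: bigmin_le_cond.
have t01 : 0 <= t <= 1.
  rewrite bigmin_le_id andbT; apply: le_bigmin => // i _.
  by have /andP[] := mu01 (tnth x i).
(* An argument of the operation exists because the arity is positive. *)
have mut0 : level_subset mu t !=set0.
  by exists (tnth x (Ordinal (ltnW (arity_ge2 G)))); apply: t_le.
by have [_ mut_op _] := sub t t01 mut0; apply: mut_op.
Qed.
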